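(* Let $a<b$ be real numbers, let $I=[a,b]$, let $\varphi: I\to\mathbb{R}$ be a bounded, Riemann integrable function, and let $\Phi$ be an indefinite integral of $\varphi$ on $I$, i.e. $\Phi(x)=\Phi(a)+\int_{[a,x]}\varphi$ for all $x\in I$. Let $f$ be a bounded real-valued function on $\Phi(I)$, the range of $\Phi$. Then $f$ is Riemann integrable on $\Phi(I)$ if and only if $f(\Phi)\,\varphi$ is Riemann integrable on $I$, and, in that case, with $\mathcal{I}=[\Phi(a),\Phi(b)]$, $$\int_{\mathcal{I}} f=\int_I f(\Phi)\,\varphi .$$
   Context: Here $f(\Phi)$ denotes the composition $x\mapsto f(\Phi(x))$, and $f(\Phi)\,\varphi$ is the pointwise product $x\mapsto f(\Phi(x))\varphi(x)$ on $I$. All integrals are (proper) Riemann integrals. The function $\varphi$ may change sign. The range $\Phi(I)$ is a closed bounded interval (since $\Phi$ is continuous), but $\Phi(a)$ and $\Phi(b)$ need not be its endpoints. The integral over $\mathcal{I}=[\Phi(a),\Phi(b)]$ is oriented: $\int_{\mathcal{I}} f=\int_{\Phi(a)}^{\Phi(b)} f(y)\,dy$, which equals $-\int_{\Phi(b)}^{\Phi(a)}f(y)\,dy$ when $\Phi(b)<\Phi(a)$, and is $0$ when $\Phi(a)=\Phi(b)$. *)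

(* Defs.v *)
From Stdlib Require Import Reals.
From Coquelicot Require Import Coquelicot.

Open Scope R_scope.

Definition segment (a b : R) : R -> Prop := fun x => a <= x <= b.

Definition image (g : R -> R) (S : R -> Prop) : R -> Prop :=
  fun y => exists x, S x /\ g x = y.

Definition bounded_on (g : R -> R) (S : R -> Prop) : Prop :=
  exists K, forall x, S x -> Rabs (g x) <= K.

(* Functions defined on a segment are represented by total functions.  This is
   harmless: [ex_RInt g a b], [RInt g a b] and [bounded_on g S] only depend on
   the values of [g] on the segment with endpoints [a] and [b], resp. on [S]. *)

(* Riemann integrability over a set that is a closed bounded interval (whose
   endpoints are then determined by [S]); a one-point interval is allowed, and
   every function is integrable over it. *)
Definition Riemann_integrable_on (g : R -> R) (S : R -> Prop) : Prop :=
  exists m M, m <= M /\ (forall y, S y <-> segment m M y) /\ ex_RInt g m M.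

Definition indefinite_integral_on (a b : R) (phi Phi : R -> R) : Prop :=
  forall x, segment a b x -> Phi x = Phi a + RInt phi a x.

(* Main.v *)
(** A step-function approximation splits [[a, b]] into pieces on
    which [phi] is within [d] of a constant [c], at total cost [sum d * length]
    as small as desired.  If [|c| > d] then [phi] has constant sign on the piece;
    if [|c| <= d] then [|phi| <= 2 d] there, so that both the integral of
    [f(Phi) phi] over the piece and that of [f] over its image are negligible.
    On a piece of constant sign [Phi] is monotone, and the substitution rule
    follows by pulling back the pieces on which [f] itself is nearly constant.

    For the converse the pieces are chosen so that [f(Phi) phi] is also within
    [d'] of a constant [c'].  When [|c| > d], [f(Phi)] is within
    [(d' + K d) / |c|] of [c' / c], on an image of length at most
    [2 |c| * length]: the factor [|c|] cancels.  The images of the pieces may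
    overlap, but they are intervals covering [Phi(I)], so the approximations of
    [f] on them can be glued. *)
Require Import Defs.
From Stdlib Require Import Reals Lra List Lia.
From Coquelicot Require Import Coquelicot.

Open Scope R_scope.

(** * Costs that add up along step-function approximations *)

(** A relation [P u v e] is read: "on [[u, v]] some approximation is available
    with error [e]". *)
Definition additive_cost (P : R -> R -> R -> Prop) (m M : R) : Prop :=
  forall u v w e1 e2, m <= u <= v -> v <= w <= M ->
  P u v e1 -> P v w e2 -> P u w (e1 + e2).

Definition monotone_cost (P : R -> R -> R -> Prop) : Prop :=
  forall u v e1 e2, e1 <= e2 -> P u v e1 -> P u v e2.

(** Additivity and monotonicity pass to this relation, so an induction that loses a little on each
    piece can be run on it. The excess is absorbed at the end, where the conclusion is asked for
    every positive [eps]. *)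
Definition with_slack (P : R -> R -> R -> Prop) (u v e : R) : Prop :=
  forall eta, 0 < eta -> P u v (e + eta).

Lemma additive_with_slack (P : R -> R -> R -> Prop) (m M : R) :
  additive_cost P m M -> additive_cost (with_slack P) m M.
Proof.
intros Hadd u v w e1 e2 Hu Hv H1 H2 eta Heta.
replace (e1 + e2 + eta) with ((e1 + eta / 2) + (e2 + eta / 2)) by field.
apply Hadd with v; auto; [apply H1|apply H2]; lra.
Qed.

Lemma monotone_with_slack (P : R -> R -> R -> Prop) :
  monotone_cost P -> monotone_cost (with_slack P).
Proof.
intros Hmono u v e1 e2 He H1 eta Heta.
apply Hmono with (e1 + eta); [lra|auto].
Qed.

Lemma with_slack_absorb (P : R -> R -> R -> Prop) (u v : R) :
  (forall eps, 0 < eps -> with_slack P u v eps) ->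
  forall eps, 0 < eps -> P u v eps.
Proof.
intros H eps Heps.
replace eps with (eps / 2 + eps / 2) by field.
apply H; lra.
Qed.

Lemma ex_RInt_subsegment (f : R -> R) (m u v M : R) :
  m <= u -> u <= v -> v <= M -> ex_RInt f m M -> ex_RInt f u v.
Proof.
intros Hu Huv Hv Hf.
apply (@ex_RInt_Chasles_1 R_CompleteNormedModule) with M; [lra|].
apply (@ex_RInt_Chasles_2 R_CompleteNormedModule) with m; [lra|exact Hf].
Qed.

(** [Int_SF] sums value times length over the pieces, so adding the costs of the pieces by
    [additive_cost] gives exactly this sum. *)
Lemma adapted_couple_ind (s : R -> R) (P : R -> R -> R -> Prop) (m M : R)
  (l lf : list R) :
  m <= M -> adapted_couple s m M l lf -> additive_cost P m M ->
  (forall u v c, m <= u -> u <= v -> v <= M ->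
    (forall t, u < t < v -> s t = c) -> P u v (c * (v - u))) ->
  P m M (Int_SF lf l).
Proof.
intros hmM (Hord & H0 & Hl & Hlen & Hc) Hadd Hbase.
rewrite Rmin_left in H0 by assumption.
rewrite Rmax_right in Hl by assumption.
destruct l as [|x l]; [discriminate|].
simpl in H0; subst x.
(* The left end is made arbitrary so that the first piece can be peeled off. [x <= M] is proved
   along, since additivity only applies inside the segment. *)
assert (Hgen : forall l x lf, m <= x ->
  RList.ordered_Rlist (x :: l) ->
  RList.pos_Rl (x :: l) (length l) = M ->
  length l = length lf ->
  (forall i, (i < length l)%nat ->
    constant_D_eq s (open_interval (RList.pos_Rl (x :: l) i)
       (RList.pos_Rl (x :: l) (S i))) (RList.pos_Rl lf i)) ->
  x <= M /\ P x M (Int_SF lf (x :: l))).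
{ clear l lf Hord Hl Hlen Hc.
  induction l as [|y l IH]; intros x lf hx Hord Hl Hlen Hc.
  - destruct lf; [|discriminate]. simpl in *. subst x.
    split; [lra|].
    replace 0 with (0 * (M - M)) by ring.
    apply Hbase; try lra; intros; lra.
  - destruct lf as [|c lf]; [discriminate|].
    assert (hxy : x <= y) by (apply (Hord O); simpl; lia).
    destruct (IH y lf) as [hy HP].
    + lra.
    + intros i Hi; apply (Hord (S i)); simpl in *; lia.
    + exact Hl.
    + simpl in Hlen; lia.
    + intros i Hi; apply (Hc (S i)); simpl; lia.
    + split; [lra|].
      simpl. apply Hadd with y; try lra; [|exact HP].
      apply Hbase; try lra.
      intros t Ht. apply (Hc O); [simpl; lia|exact Ht]. }
simpl in Hl, Hlen.
apply Hgen; auto; lra.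
Qed.

(** Integrability yields step functions [s] and [psi] with [|f - s| <= psi] and the integral of
    [psi] below [eps]. Where both are constant, [f] is within the value of [psi] of the value of
    [s], so the total cost is the integral of [psi]. *)
Lemma ex_RInt_cost_ind_open (f : R -> R) (P : R -> R -> R -> Prop) (m M : R) :
  m <= M -> ex_RInt f m M -> additive_cost P m M -> monotone_cost P ->
  (forall u v c d, m <= u -> u <= v -> v <= M ->
    (forall t, u < t < v -> Rabs (f t - c) <= d) -> P u v (d * (v - u))) ->
  forall eps, 0 < eps -> P m M eps.
Proof.
intros hmM Hf Hadd Hmono Hbase eps Heps.
destruct (ex_RInt_Reals_0 f m M Hf (mkposreal eps Heps))
  as [[s [ls [lfs Hs]]] [[psi [lp [lfp Hpsi]]] [Happ Hint]]].
simpl in Happ, Hint.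
unfold RiemannInt_SF in Hint; simpl in Hint.
destruct (Rle_dec m M) as [_|]; [|contradiction].
apply Hmono with (Int_SF lfp lp).
{ apply Rabs_def2 in Hint; unfold subdivision_val, subdivision in Hint; simpl in Hint; lra. }
apply (adapted_couple_ind psi); auto.
intros u v d hmu huv hvM Hd.
assert (Hsuv : IsStepFun s u v).
{ apply StepFun_P45 with m; [|lra].
  apply StepFun_P44 with M; [|lra].
  exact (existT _ ls (existT _ lfs Hs)). }
destruct Hsuv as [l [lf Hl]].
(* Second pass, over the pieces of [s] inside one piece of [psi]: the relation ignores the integral
   of [s] and keeps only the cost [d * (y - x)]. *)
apply (adapted_couple_ind s (fun x y _ => P x y (d * (y - x))) u v l lf huv Hl).
- intros x y z _ _ Hxy Hyz Hx Hy.
  replace (d * (z - x)) with (d * (y - x) + d * (z - y)) by ring.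
  apply Hadd with y; auto; lra.
- intros x y c Hx Hxy Hy Hc.
  apply Hbase with c; try lra.
  intros t Ht. rewrite <- (Hc t Ht), <- (Hd t) by lra.
  apply Happ. rewrite Rmin_left, Rmax_right; lra.
Qed.

(** Step functions are constant only on open pieces, while the estimates on images under [Phi] use
    closed ones. As [f] is bounded, two thin end slices cost at most [eta] together, which the slack
    allows. *)
Lemma ex_RInt_cost_ind (f : R -> R) (P : R -> R -> R -> Prop) (m M : R) :
  m <= M -> ex_RInt f m M -> bounded_on f (segment m M) ->
  additive_cost P m M -> monotone_cost P ->
  (forall u v c d, m <= u -> u <= v -> v <= M ->
    (forall t, segment u v t -> Rabs (f t - c) <= d) -> P u v (d * (v - u))) ->
  forall eps, 0 < eps -> P m M eps.
Proof.
intros hmM Hf [K HK] Hadd Hmono Hbase.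
apply with_slack_absorb.
apply (ex_RInt_cost_ind_open f (with_slack P) m M hmM Hf);
  auto using additive_with_slack, monotone_with_slack.
- intros u v c d Hu Huv Hv Hd eta Heta.
  destruct (Req_dec u v) as [<-|Hne].
  { apply Hmono with (0 * (u - u)); [lra|].
    apply Hbase with (f u); try lra.
    intros t [Ht1 Ht2]. replace t with u by lra.
    rewrite Rminus_diag, Rabs_R0; lra. }
  assert (HK0 : 0 <= K).
  { apply Rle_trans with (Rabs (f u)); [apply Rabs_pos|apply HK; split; lra]. }
  assert (Hd0 : 0 <= d).
  { apply Rle_trans with (Rabs (f ((u + v) / 2) - c)); [apply Rabs_pos|apply Hd; lra]. }
  (* the end points are cut off by short intervals, on which [f] is only known to be bounded *)
  set (th := Rmin ((v - u) / 2) (eta / (2 * (K + 1)))).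
  assert (Hth : 0 < th).
  { apply Rmin_pos; [lra|]. apply Rdiv_lt_0_compat; lra. }
  assert (Hth1 : th <= (v - u) / 2) by apply Rmin_l.
  assert (Hth2 : 2 * (K * th) <= eta).
  { assert (H : th <= eta / (2 * (K + 1))) by apply Rmin_r.
    apply Rmult_le_compat_r with (r := 2 * (K + 1)) in H; [|lra].
    replace (eta / (2 * (K + 1)) * (2 * (K + 1))) with eta in H by (field; lra).
    nra. }
  apply Hmono with (K * (u + th - u) + (d * (v - th - (u + th)) + K * (v - (v - th)))).
  { nra. }
  apply Hadd with (u + th); try lra.
  { apply Hbase with 0; try lra.
    intros t [Ht1 Ht2]; rewrite Rminus_0_r; apply HK; split; lra. }
  apply Hadd with (v - th); try lra.
  { apply Hbase with c; try lra.
    intros t [Ht1 Ht2]; apply Hd; lra. }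
  apply Hbase with 0; try lra.
  intros t [Ht1 Ht2]; rewrite Rminus_0_r; apply HK; split; lra.
Qed.

(** Two nested inductions: a piece on which [f] is within [d] of a constant is subdivided again for
    [g], with the additive charge [d * (y - x)] included in the cost. The inner error is the slack
    of the outer induction. *)
Lemma ex_RInt_cost_ind2 (f g : R -> R) (P : R -> R -> R -> Prop) (m M : R) :
  m <= M -> ex_RInt f m M -> ex_RInt g m M ->
  bounded_on f (segment m M) -> bounded_on g (segment m M) ->
  additive_cost P m M -> monotone_cost P ->
  (forall u v c d c' d', m <= u -> u <= v -> v <= M ->
    (forall t, segment u v t -> Rabs (f t - c) <= d) ->
    (forall t, segment u v t -> Rabs (g t - c') <= d') ->
    P u v ((d + d') * (v - u))) ->
  forall eps, 0 < eps -> P m M eps.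
Proof.
intros hmM Hf Hg Bf [K HK] Hadd Hmono Hbase.
apply with_slack_absorb.
apply (ex_RInt_cost_ind f (with_slack P) m M hmM Hf Bf);
  auto using additive_with_slack, monotone_with_slack.
- intros u v c d Hu Huv Hv Hd eta Heta.
  apply (ex_RInt_cost_ind g (fun x y e => P x y (d * (y - x) + e)) u v Huv);
    [| | | | |exact Heta].
  + apply ex_RInt_subsegment with m M; auto; lra.
  + exists K; intros t [Ht1 Ht2]; apply HK; split; lra.
  + intros x y z e1 e2 Hx Hy H1 H2.
    replace (d * (z - x) + (e1 + e2))
      with ((d * (y - x) + e1) + (d * (z - y) + e2)) by ring.
    apply Hadd with y; auto; lra.
  + intros x y e1 e2 He; apply Hmono; lra.
  + intros x y c' d' Hx Hxy Hy Hd'.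
    replace (d * (y - x) + d' * (y - x)) with ((d + d') * (y - x)) by ring.
    apply Hbase with c c'; try lra; auto.
    intros t [Ht1 Ht2]; apply Hd; split; lra.
Qed.

(** * Gluing functions, and integrability by approximation *)

Definition splice (p q : R) (g1 g2 : R -> R) (y : R) : R :=
  if Rle_dec p y then if Rle_dec y q then g1 y else g2 y else g2 y.

Lemma splice_in (p q : R) (g1 g2 : R -> R) (y : R) :
  p <= y <= q -> splice p q g1 g2 y = g1 y.
Proof.
intros [H1 H2]; unfold splice.
destruct (Rle_dec p y); [|lra]; destruct (Rle_dec y q); lra.
Qed.

Lemma splice_out (p q : R) (g1 g2 : R -> R) (y : R) :
  y < p \/ q < y -> splice p q g1 g2 y = g2 y.
Proof.
intros H; unfold splice.
destruct (Rle_dec p y); [|lra]; destruct (Rle_dec y q); lra.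
Qed.

Lemma is_RInt_splice (m p q M : R) (g1 g2 : R -> R) (A B C : R) :
  m <= p -> p <= q -> q <= M ->
  is_RInt g2 m p A -> is_RInt g1 p q B -> is_RInt g2 q M C ->
  is_RInt (splice p q g1 g2) m M (A + B + C).
Proof.
intros Hmp Hpq HqM HA HB HC.
apply (is_RInt_Chasles _ m q M (A + B) C).
- apply (is_RInt_Chasles _ m p q A B).
  + apply is_RInt_ext with g2; [|exact HA].
    rewrite Rmin_left, Rmax_right by assumption.
    intros x Hx; rewrite splice_out; lra.
  + apply is_RInt_ext with g1; [|exact HB].
    rewrite Rmin_left, Rmax_right by assumption.
    intros x Hx; rewrite splice_in; lra.
- apply is_RInt_ext with g2; [|exact HC].
  rewrite Rmin_left, Rmax_right by assumption.
  intros x Hx; rewrite splice_out; lra.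
Qed.

Lemma is_RInt_real_const (c u v : R) : is_RInt (fun _ => c) u v (c * (v - u)).
Proof. rewrite Rmult_comm; exact (is_RInt_const u v c). Qed.

(** A Darboux-type criterion: [F] lies between [g - h] and [g + h]. The bounds are arbitrary
    integrable functions, not step functions, so that multiples of [phi], or [F] itself, can serve
    as [g]. *)
Definition integral_within (F : R -> R) (u v I e : R) : Prop :=
  exists g h Ig Ih, is_RInt g u v Ig /\ is_RInt h u v Ih /\
    (forall t, segment u v t -> Rabs (F t - g t) <= h t) /\
    Ih <= e /\ Rabs (Ig - I) <= e.

Lemma integral_within_exact (F : R -> R) (u v I e : R) :
  is_RInt F u v I -> 0 <= e -> integral_within F u v I e.
Proof.
intros HF He.
exists F, (fun _ => 0), I, 0; repeat split; auto.
- assert (H := is_RInt_real_const 0 u v); rewrite Rmult_0_l in H; exact H.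
- intros t _; rewrite Rminus_diag, Rabs_R0; lra.
- rewrite Rminus_diag, Rabs_R0; lra.
Qed.

Lemma integral_within_mono (F : R -> R) (u v I e1 e2 : R) :
  e1 <= e2 -> integral_within F u v I e1 -> integral_within F u v I e2.
Proof.
intros He (g & h & Ig & Ih & Hg & Hh & Hb & H1 & H2).
exists g, h, Ig, Ih; repeat split; auto; lra.
Qed.

Lemma integral_within_Chasles (F : R -> R) (u v w I1 I2 e1 e2 : R) :
  u <= v -> v <= w ->
  integral_within F u v I1 e1 -> integral_within F v w I2 e2 ->
  integral_within F u w (I1 + I2) (e1 + e2).
Proof.
intros Huv Hvw (g1 & h1 & Ig1 & Ih1 & Hg1 & Hh1 & Hb1 & He1 & HI1)
  (g2 & h2 & Ig2 & Ih2 & Hg2 & Hh2 & Hb2 & He2 & HI2).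
assert (Hpatch : forall k1 k2 J1 J2, is_RInt k1 u v J1 -> is_RInt k2 v w J2 ->
  is_RInt (splice u v k1 k2) u w (J1 + J2)).
{ intros k1 k2 J1 J2 H1 H2.
  replace (J1 + J2) with (0 + J1 + J2) by ring.
  apply is_RInt_splice; auto; try lra.
  exact (is_RInt_point k2 u). }
exists (splice u v g1 g2), (splice u v h1 h2), (Ig1 + Ig2), (Ih1 + Ih2).
repeat split; auto; try lra.
- intros t [Ht1 Ht2].
  destruct (Rle_dec t v).
  + rewrite !splice_in by lra. apply Hb1; split; lra.
  + rewrite !splice_out by lra. apply Hb2; split; lra.
- replace (Ig1 + Ig2 - (I1 + I2)) with ((Ig1 - I1) + (Ig2 - I2)) by ring.
  eapply Rle_trans; [apply Rabs_triang|lra].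
Qed.

(** The sums of [F] and [g] differ by at most the sum of [h]. On fine subdivisions the latter is at
    most [e + eta / 2], the sum of [g] is within [eta / 2] of [Ig], and [Ig] is within [e] of
    [I]. *)
Lemma integral_within_Riemann_sum (F : R -> R) (u v I e eta : R) :
  u <= v -> 0 < eta -> integral_within F u v I e ->
  Riemann_fine u v
    (fun ptd => Rabs (scal (sign (v - u)) (Riemann_sum F ptd) - I) <= 2 * e + eta).
Proof.
intros Huv Heta (g & h & Ig & Ih & Hg & Hh & Hb & He & HI).
assert (Heta2 : 0 < eta / 2) by lra.
assert (Gg := proj1 (filterlim_locally _ _) Hg (mkposreal _ Heta2)).
assert (Gh := proj1 (filterlim_locally _ _) Hh (mkposreal _ Heta2)).
assert (Gb : Riemann_fine u v (fun ptd =>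
  Rabs (Riemann_sum F ptd - Riemann_sum g ptd) <= Riemann_sum h ptd)).
(* The comparison holds for every tagged subdivision, so the mesh 1 is arbitrary. *)
{ exists (mkposreal 1 Rlt_0_1).
  intros ptd _ (Hptd & H0 & Hl).
  rewrite Rmin_left in H0 by assumption.
  rewrite Rmax_right in Hl by assumption.
  assert (E : Riemann_sum F ptd - Riemann_sum g ptd
    = Riemann_sum (fun x => F x - g x) ptd)
    by exact (eq_sym (Riemann_sum_minus F g ptd)).
  rewrite E.
  apply (Riemann_sum_norm (fun x => F x - g x) h ptd Hptd).
  intros t Ht; apply Hb; rewrite Hl, H0 in Ht; exact Ht. }
(* The sign factor of the Riemann sums is 1, or 0 when [u = v]. *)
assert (Hs : 0 <= sign (v - u)).
{ destruct (Req_dec u v) as [->|Hne].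
  - rewrite Rminus_diag, sign_0; lra.
  - rewrite sign_eq_1; lra. }
generalize (filter_and _ _ Gb (filter_and _ _ Gg Gh)).
apply filter_imp; intros ptd (H1 & H2 & H3).
unfold ball in H2, H3; simpl in H2, H3; unfold AbsRing_ball, abs, minus, plus, opp in H2, H3; simpl in H2, H3.
unfold scal in *; simpl in *; unfold mult in *; simpl in *.
set (s := sign (v - u)) in *.
apply Rabs_def2 in H2; apply Rabs_def2 in H3.
apply (Rmult_le_compat_l s) in H1; [|exact Hs].
rewrite <- (Rabs_pos_eq s) in H1 at 1 by exact Hs.
rewrite <- Rabs_mult in H1.
apply Rabs_le_between in H1; apply Rabs_le_between in HI; apply Rabs_le_between.
lra.
Qed.

Lemma is_RInt_of_integral_within (F : R -> R) (u v I : R) :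
  u <= v -> (forall e, 0 < e -> integral_within F u v I e) -> is_RInt F u v I.
Proof.
intros Huv H.
apply filterlim_locally; intros [eps Heps].
assert (He : 0 < eps / 4) by lra.
generalize (integral_within_Riemann_sum F u v I _ _ Huv He (H _ He)).
apply filter_imp; intros ptd Hp.
change (Rabs (scal (sign (v - u)) (Riemann_sum F ptd) - I) < eps).
lra.
Qed.

(** Here [I] may vary with [e], so the Cauchy criterion is used: with [e = eps / 8], two fine
    Riemann sums are both within [3 * eps / 8] of the same [I]. *)
Lemma ex_RInt_of_integral_within (F : R -> R) (u v : R) :
  u <= v -> (forall e, 0 < e -> exists I, integral_within F u v I e) ->
  ex_RInt F u v.
Proof.
intros Huv H.
apply (proj1 (filterlim_locally_cauchy (U := R_CompleteSpace) (F := Riemann_fine u v)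
  (fun ptd => scal (sign (v - u)) (Riemann_sum F ptd)))); intros [eps Heps].
assert (He : 0 < eps / 8) by lra.
destruct (H _ He) as [I HI].
eexists; split; [exact (integral_within_Riemann_sum F u v I _ _ Huv He HI)|].
intros p q Hp Hq.
change (Rabs (scal (sign (v - u)) (Riemann_sum F q) - scal (sign (v - u)) (Riemann_sum F p)) < eps).
apply Rabs_le_between in Hp; apply Rabs_le_between in Hq; apply Rabs_def1; lra.
Qed.

(** * Primitives, Lipschitz functions and their images *)

Lemma RInt_near_const (f : R -> R) (u v c d : R) :
  u <= v -> ex_RInt f u v -> (forall t, segment u v t -> Rabs (f t - c) <= d) ->
  Rabs (c * (v - u) - RInt f u v) <= d * (v - u).
Proof.
intros Huv Hf Hd.
apply (norm_RInt_le (fun t => c - f t) (fun _ => d) u v _ _ Huv).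
- intros t Ht; rewrite <- Rabs_Ropp, Ropp_minus_distr; apply Hd; exact Ht.
- apply (is_RInt_minus (fun _ => c) f); [apply is_RInt_real_const|exact (RInt_correct f u v Hf)].
- apply is_RInt_real_const.
Qed.

Lemma RInt_abs_le_const (f : R -> R) (u v K : R) :
  u <= v -> ex_RInt f u v -> (forall t, segment u v t -> Rabs (f t) <= K) ->
  Rabs (RInt f u v) <= K * (v - u).
Proof.
intros Huv Hf HK.
rewrite Rmult_comm; apply abs_RInt_le_const; auto.
Qed.

(** Without a base point the property restricts to subsegments and survives negation. It also
    carries the integrability of [phi]. *)
Definition primitive_on (u v : R) (phi Phi : R -> R) : Prop :=
  forall x y, u <= x -> x <= y -> y <= v -> is_RInt phi x y (Phi y - Phi x).

Lemma primitive_subsegment (u x y v : R) (phi Phi : R -> R) :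
  u <= x -> y <= v -> primitive_on u v phi Phi -> primitive_on x y phi Phi.
Proof. intros Hu Hv H s t Hs Hst Ht; apply H; lra. Qed.

Definition Lipschitz_on (L u v : R) (Phi : R -> R) : Prop :=
  forall x y, u <= x -> x <= y -> y <= v -> Rabs (Phi y - Phi x) <= L * (y - x).

Lemma primitive_Lipschitz (L u v : R) (phi Phi : R -> R) :
  primitive_on u v phi Phi -> (forall t, segment u v t -> Rabs (phi t) <= L) ->
  Lipschitz_on L u v Phi.
Proof.
intros H HL x y Hx Hxy Hy.
assert (Hxy' := H x y Hx Hxy Hy).
rewrite <- (is_RInt_unique _ _ _ _ Hxy').
apply RInt_abs_le_const; auto.
- exists (Phi y - Phi x); exact Hxy'.
- intros t [Ht1 Ht2]; apply HL; split; lra.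
Qed.

(** Composing with this retraction extends a Lipschitz function on [[u, v]] to a continuous function
    on the line, to which the intermediate and extreme value theorems are applied. *)
Definition clamp (u v x : R) : R := Rmax u (Rmin v x).

Lemma clamp_in (u v x : R) : u <= v -> u <= clamp u v x <= v.
Proof. intros H; unfold clamp, Rmax, Rmin; repeat destruct Rle_dec; lra. Qed.

Lemma clamp_id (u v x : R) : u <= x <= v -> clamp u v x = x.
Proof. intros H; unfold clamp, Rmax, Rmin; repeat destruct Rle_dec; lra. Qed.

Lemma Lipschitz_clamp_continuity (L u v : R) (Phi : R -> R) :
  u <= v -> Lipschitz_on L u v Phi -> continuity (fun x => Phi (clamp u v x)).
Proof.
intros Huv HL.
(* [clamp] is nondecreasing and 1-Lipschitz. [Rmax 0 L] is a nonnegative constant even when [u = v]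
   and [L] is negative. *)
assert (HL' : forall x y, x <= y ->
  Rabs (Phi (clamp u v y) - Phi (clamp u v x)) <= Rmax 0 L * (y - x)).
{ intros x y Hxy.
  assert (H : clamp u v x <= clamp u v y <= clamp u v x + (y - x)).
  { unfold clamp, Rmax, Rmin; repeat destruct Rle_dec; lra. }
  eapply Rle_trans; [apply HL; try apply clamp_in; lra|].
  assert (H0 := Rmax_l 0 L); assert (H1 := Rmax_r 0 L).
  apply Rle_trans with (Rmax 0 L * (clamp u v y - clamp u v x)).
  - apply Rmult_le_compat_r; lra.
  - apply Rmult_le_compat_l; lra. }
assert (H0 := Rmax_l 0 L).
intros x eps Heps.
exists (eps / (Rmax 0 L + 1)); split; [apply Rdiv_lt_0_compat; lra|].
intros y [_ Hy]; simpl in *; unfold R_dist in *.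
assert (Hlt : (Rmax 0 L + 1) * Rabs (y - x) < eps).
{ apply Rmult_lt_compat_l with (r := Rmax 0 L + 1) in Hy; [|lra].
  replace ((Rmax 0 L + 1) * (eps / (Rmax 0 L + 1))) with eps in Hy by (field; lra).
  exact Hy. }
assert (Hp := Rabs_pos (y - x)).
apply Rle_lt_trans with (Rmax 0 L * Rabs (y - x)); [|lra].
destruct (Rle_dec x y) as [Hxy|Hxy].
- rewrite (Rabs_pos_eq (y - x)) by lra; apply HL', Hxy.
- rewrite <- Rabs_Ropp, Ropp_minus_distr, <- (Rabs_Ropp (y - x)), Ropp_minus_distr.
  rewrite (Rabs_pos_eq (x - y)) by lra; apply HL'; lra.
Qed.

Lemma Lipschitz_IVT (L u v y : R) (Phi : R -> R) :
  u <= v -> Lipschitz_on L u v Phi ->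
  Rmin (Phi u) (Phi v) <= y <= Rmax (Phi u) (Phi v) ->
  exists t, segment u v t /\ Phi t = y.
Proof.
intros Huv HL Hy.
destruct (IVT_gen (fun x => Phi (clamp u v x)) u v y) as [x [_ Hx]].
- apply (Lipschitz_clamp_continuity L); auto.
- rewrite !clamp_id by lra; exact Hy.
- exists (clamp u v x); split; [apply clamp_in; exact Huv|exact Hx].
Qed.

(** The extrema are attained at some [s] and [t], and all values between them are taken between [s]
    and [t]. The length is [|Phi t - Phi s|], hence at most [L * |t - s|]. Either of [s], [t] may
    come first. *)
Lemma Lipschitz_image_segment (L u v : R) (Phi : R -> R) :
  u <= v -> 0 <= L -> Lipschitz_on L u v Phi ->
  exists p q, p <= q /\ q - p <= L * (v - u) /\
    forall y, image Phi (segment u v) y <-> segment p q y.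
Proof.
intros Huv HL0 HL.
assert (Hc := Lipschitz_clamp_continuity L u v Phi Huv HL).
destruct (continuity_ab_min (fun x => Phi (clamp u v x)) u v Huv (fun c _ => Hc c))
  as [s [Hs Hsi]].
destruct (continuity_ab_maj (fun x => Phi (clamp u v x)) u v Huv (fun c _ => Hc c))
  as [t [Ht Hti]].
rewrite clamp_id in Hs by exact Hsi.
rewrite clamp_id in Ht by exact Hti.
assert (Hs' : forall x, u <= x <= v -> Phi s <= Phi x).
{ intros x Hx; rewrite <- (clamp_id u v x) by exact Hx; apply Hs, Hx. }
assert (Ht' : forall x, u <= x <= v -> Phi x <= Phi t).
{ intros x Hx; rewrite <- (clamp_id u v x) by exact Hx; apply Ht, Hx. }
assert (Hst := Ht' s Hsi).
exists (Phi s), (Phi t); repeat split.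
- exact Hst.
- rewrite <- (Rabs_pos_eq (Phi t - Phi s)) by lra.
  destruct (Rle_dec s t) as [H|H].
  + eapply Rle_trans; [apply HL; lra|apply Rmult_le_compat_l; lra].
  + rewrite <- Rabs_Ropp, Ropp_minus_distr.
    eapply Rle_trans; [apply HL; lra|apply Rmult_le_compat_l; lra].
- destruct H as [x [Hx <-]]; apply Hs', Hx.
- destruct H as [x [Hx <-]]; apply Ht', Hx.
- intros [H1 H2].
  destruct (Rle_dec s t) as [H|H].
  + destruct (Lipschitz_IVT L s t y Phi) as [x [[Hx1 Hx2] Hx]].
    * exact H.
    * intros x1 x2 h1 h2 h3; apply HL; lra.
    * rewrite Rmin_left, Rmax_right; lra.
    * exists x; split; [split; lra|exact Hx].
  + destruct (Lipschitz_IVT L t s y Phi) as [x [[Hx1 Hx2] Hx]].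
    * lra.
    * intros x1 x2 h1 h2 h3; apply HL; lra.
    * rewrite Rmin_right, Rmax_left; lra.
    * exists x; split; [split; lra|exact Hx].
Qed.

Lemma primitive_nondecreasing (u v x y : R) (phi Phi : R -> R) :
  primitive_on u v phi Phi -> (forall t, segment u v t -> 0 <= phi t) ->
  u <= x -> x <= y -> y <= v -> Phi x <= Phi y.
Proof.
intros H H0 Hx Hxy Hy.
assert (Hi := H x y Hx Hxy Hy).
assert (0 <= Phi y - Phi x); [|lra].
rewrite <- (Rmult_0_l (y - x)).
apply (is_RInt_le (fun _ => 0) phi x y); auto.
- apply is_RInt_real_const.
- intros t Ht; apply H0; split; lra.
Qed.

(** * The substitution rule, first for [phi] of constant sign *)

(** The induction runs over the range, along pieces where [f] is nearly constant. [Phi] being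
    monotone, each piece pulls back to an interval. *)
Lemma is_RInt_subst_nonneg (L u v : R) (phi Phi f : R -> R) :
  u <= v -> primitive_on u v phi Phi ->
  (forall t, segment u v t -> 0 <= phi t <= L) ->
  ex_RInt f (Phi u) (Phi v) -> bounded_on f (segment (Phi u) (Phi v)) ->
  is_RInt (fun x => f (Phi x) * phi x) u v (RInt f (Phi u) (Phi v)).
Proof.
intros Huv Hprim Hphi Hf Bf.
assert (HL : Lipschitz_on L u v Phi).
{ apply (primitive_Lipschitz L u v phi Phi Hprim).
  intros t Ht; specialize (Hphi t Ht); rewrite Rabs_pos_eq; lra. }
assert (Hmon : forall x y, u <= x -> x <= y -> y <= v -> Phi x <= Phi y).
{ intros x y; apply (primitive_nondecreasing u v x y phi Phi Hprim).
  intros t Ht; apply Hphi, Ht. }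
apply is_RInt_of_integral_within; [exact Huv|].
intros e He.
(* All preimages [x], [x'] of the ends are allowed, because [Phi] may be constant on intervals.
   Additivity then needs just one intermediate preimage. *)
cut ((fun y y' e => forall x x', u <= x -> x <= x' -> x' <= v -> Phi x = y -> Phi x' = y' ->
  integral_within (fun t => f (Phi t) * phi t) x x' (RInt f y y') e) (Phi u) (Phi v) e).
{ intros H; apply H; auto; lra. }
apply (ex_RInt_cost_ind f); auto.
- apply Hmon; lra.
- intros y1 y2 y3 e1 e2 H1 H2 P1 P2 x x' Hx Hxx' Hx' E E'.
  destruct (Lipschitz_IVT L x x' y2 Phi) as [t [[Ht1 Ht2] Ht]].
  + exact Hxx'.
  + intros s t Hs Hst Ht; apply HL; lra.
  + rewrite E, E', Rmin_left, Rmax_right; lra.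
  + replace (RInt f y1 y3) with (RInt f y1 y2 + RInt f y2 y3).
    * apply integral_within_Chasles with t; try lra; [apply P1|apply P2]; auto; lra.
    * apply (RInt_Chasles f y1 y2 y3);
        apply ex_RInt_subsegment with (Phi u) (Phi v); auto; lra.
- intros y y' e1 e2 He12 P1 x x' Hx Hxx' Hx' E E'.
  apply integral_within_mono with e1; auto.
- intros y y' c d Hy Hyy' Hy' Hd x x' Hx Hxx' Hx' <- <-.
  assert (Hi := Hprim x x' Hx Hxx' Hx').
  (* The error function [d * phi] integrates to [d * (Phi x' - Phi x)], the cost of the piece in the
     range. *)
  exists (fun t => c * phi t), (fun t => d * phi t), (c * (Phi x' - Phi x)), (d * (Phi x' - Phi x)).
  repeat split.
  + exact (is_RInt_scal phi x x' c _ Hi).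
  + exact (is_RInt_scal phi x x' d _ Hi).
  + intros t [Ht1 Ht2].
    assert (Hp : 0 <= phi t <= L) by (apply Hphi; split; lra).
    replace (f (Phi t) * phi t - c * phi t) with ((f (Phi t) - c) * phi t) by ring.
    rewrite Rabs_mult, (Rabs_pos_eq (phi t)) by lra.
    apply Rmult_le_compat_r; [lra|].
    apply Hd; split; apply Hmon; lra.
  + lra.
  + apply RInt_near_const; auto.
    apply ex_RInt_subsegment with (Phi u) (Phi v); auto.
Qed.

Lemma is_RInt_real_opp_arg (f : R -> R) (p q I : R) :
  is_RInt f p q I -> is_RInt (fun y => f (- y)) (- p) (- q) (- I).
Proof.
intros H.
assert (H1 := is_RInt_comp_opp f (- p) (- q) I).
rewrite !Ropp_involutive in H1.
assert (H2 := is_RInt_opp _ _ _ _ (H1 H)).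
apply is_RInt_ext with (2 := H2).
intros x _; exact (Ropp_involutive (f (- x))).
Qed.

(** Reflection: the nonnegative case is applied to [- phi], [- Phi] and [y => f (- y)]. *)
Lemma is_RInt_subst_nonpos (L u v : R) (phi Phi f : R -> R) :
  u <= v -> primitive_on u v phi Phi ->
  (forall t, segment u v t -> 0 <= - phi t <= L) ->
  ex_RInt f (Phi v) (Phi u) -> bounded_on f (segment (Phi v) (Phi u)) ->
  is_RInt (fun x => f (Phi x) * phi x) u v (RInt f (Phi u) (Phi v)).
Proof.
intros Huv Hprim Hphi Hf [K HK].
assert (Hf' := ex_RInt_swap _ _ _ Hf).
assert (Hop := is_RInt_real_opp_arg _ _ _ _ (RInt_correct _ _ _ Hf')).
assert (H : is_RInt (fun x => f (- - Phi x) * - phi x) u v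
  (RInt (fun y => f (- y)) (- Phi u) (- Phi v))).
{ apply (is_RInt_subst_nonneg L u v (fun x => - phi x) (fun x => - Phi x) (fun y => f (- y)));
    auto.
  - intros x y Hx Hxy Hy.
    replace (- Phi y - - Phi x) with (- (Phi y - Phi x)) by ring.
    exact (is_RInt_opp _ _ _ _ (Hprim x y Hx Hxy Hy)).
  - eexists; exact Hop.
  - exists K; intros t [Ht1 Ht2]; apply HK; split; lra. }
rewrite (is_RInt_unique _ _ _ _ Hop) in H.
assert (H' := is_RInt_opp _ _ _ _ H).
unfold opp in H'; simpl in H'.
rewrite Ropp_involutive in H'.
apply is_RInt_ext with (2 := H').
intros x _; unfold opp; simpl; rewrite Ropp_involutive; lra.
Qed.

Lemma is_RInt_subst (a b m M K : R) (phi Phi f : R -> R) :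
  a <= b -> primitive_on a b phi Phi -> bounded_on phi (segment a b) ->
  (forall x, segment a b x -> segment m M (Phi x)) ->
  ex_RInt f m M -> (forall y, segment m M y -> Rabs (f y) <= K) ->
  is_RInt (fun x => f (Phi x) * phi x) a b (RInt f (Phi a) (Phi b)).
Proof.
intros Hab Hprim Bphi HmM Hf HK.
assert (Hphi : ex_RInt phi a b) by (eexists; apply Hprim; lra).
assert (HK0 : 0 <= K).
{ eapply Rle_trans; [apply Rabs_pos|apply (HK (Phi a)), HmM; split; lra]. }
assert (Hsub : forall x y, segment a b x -> segment a b y -> ex_RInt f (Phi x) (Phi y)).
{ intros x y Hx Hy; apply HmM in Hx; apply HmM in Hy; unfold segment in *.
  destruct (Rle_dec (Phi x) (Phi y)).
  - apply ex_RInt_subsegment with m M; auto; lra.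
  - apply ex_RInt_swap, ex_RInt_subsegment with m M; auto; lra. }
assert (Bf : forall x y, segment a b x -> segment a b y ->
  bounded_on f (segment (Phi x) (Phi y))).
{ intros x y Hx Hy; apply HmM in Hx; apply HmM in Hy; unfold segment in *.
  exists K; intros t Ht; apply HK; lra. }
apply is_RInt_of_integral_within; [exact Hab|].
intros e He.
(* A piece with [|c| <= d] costs [2 * K * d] times its length; the added 1 keeps the divisor
   positive. *)
replace e with ((2 * K + 1) * (e / (2 * K + 1))) by (field; lra).
apply (ex_RInt_cost_ind phi (fun u v e => integral_within (fun x => f (Phi x) * phi x)
  u v (RInt f (Phi u) (Phi v)) ((2 * K + 1) * e)) a b); auto.
- intros u v w e1 e2 Hu Hv H1 H2.
  rewrite Rmult_plus_distr_l.
  replace (RInt f (Phi u) (Phi w)) with (RInt f (Phi u) (Phi v) + RInt f (Phi v) (Phi w))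
    by (apply (RInt_Chasles f); apply Hsub; split; lra).
  apply integral_within_Chasles with v; auto; lra.
- intros u v e1 e2 He12.
  apply integral_within_mono; apply Rmult_le_compat_l; lra.
- intros u v c d Hu Huv Hv Hd.
  assert (Hd0 : 0 <= d).
  { eapply Rle_trans; [apply Rabs_pos|apply (Hd u); split; lra]. }
  assert (Hdv : 0 <= d * (v - u)) by (apply Rmult_le_pos; lra).
  assert (HprimUV : primitive_on u v phi Phi)
    by (apply primitive_subsegment with a b; auto).
  assert (Su : segment a b u) by (split; lra).
  assert (Sv : segment a b v) by (split; lra).
  destruct (Rle_dec (Rabs c) d) as [Hc|Hc].
  + assert (Hphi2 : forall t, segment u v t -> Rabs (phi t) <= 2 * d).
    { intros t Ht.
      replace (phi t) with ((phi t - c) + c) by ring.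
      eapply Rle_trans; [apply Rabs_triang|specialize (Hd t Ht); lra]. }
    apply integral_within_mono with (2 * K * d * (v - u)); [lra|].
    exists (fun _ => 0), (fun _ => 2 * K * d), (0 * (v - u)), (2 * K * d * (v - u)).
    repeat split; try apply is_RInt_real_const; try lra.
    * intros t Ht; rewrite Rminus_0_r, Rabs_mult.
      replace (2 * K * d) with (K * (2 * d)) by ring.
      apply Rmult_le_compat; try apply Rabs_pos; auto.
      apply HK, HmM; destruct Ht; split; lra.
    * rewrite Rmult_0_l, Rminus_0_l, Rabs_Ropp.
      apply Rle_trans with (K * Rabs (Phi v - Phi u)).
      { assert (Bu := HmM u Su); assert (Bv := HmM v Sv); unfold segment in Bu, Bv.
        (* [phi] may change sign on this piece, so the order of [Phi u] and [Phi v] is unknown. *)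
        destruct (Rle_dec (Phi u) (Phi v)).
        - rewrite (Rabs_pos_eq (Phi v - Phi u)) by lra.
          apply RInt_abs_le_const; auto.
          intros t [Ht1 Ht2]; apply HK; split; lra.
        - rewrite <- (Rabs_Ropp (Phi v - Phi u)), Ropp_minus_distr.
          rewrite (Rabs_pos_eq (Phi u - Phi v)) by lra.
          rewrite <- (opp_RInt_swap f) by auto.
          unfold opp; simpl; rewrite Rabs_Ropp.
          apply RInt_abs_le_const; auto; try lra.
          intros t [Ht1 Ht2]; apply HK; split; lra. }
      replace (2 * K * d * (v - u)) with (K * (2 * d * (v - u))) by ring.
      apply Rmult_le_compat_l; auto.
      apply (primitive_Lipschitz (2 * d) u v phi Phi); auto; lra.
  + apply integral_within_exact; [|apply Rmult_le_pos; lra].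
    (* [phi] has the sign of [c] throughout [u, v] *)
    destruct (Rle_dec 0 c) as [Hc0|Hc0].
    * rewrite Rabs_pos_eq in Hc by lra.
      apply (is_RInt_subst_nonneg (c + d)); auto.
      intros t Ht; specialize (Hd t Ht); apply Rabs_le_between in Hd; lra.
    * rewrite Rabs_left in Hc by lra.
      apply (is_RInt_subst_nonpos (- c + d)); auto.
      intros t Ht; specialize (Hd t Ht); apply Rabs_le_between in Hd; lra.
- apply Rdiv_lt_0_compat; lra.
Qed.

(** * The converse: integrability of [f] recovered from [f(Phi) phi] *)

Lemma ex_RInt_splice (m p q M : R) (g1 g2 : R -> R) :
  m <= p -> p <= q -> q <= M -> ex_RInt g1 m M -> ex_RInt g2 m M ->
  ex_RInt (splice p q g1 g2) m M.
Proof.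
intros Hmp Hpq HqM H1 H2.
eexists; apply is_RInt_splice; auto;
  apply (RInt_correct (V := R_CompleteNormedModule)), ex_RInt_subsegment with m M; auto; lra.
Qed.

(** The estimate concerns only the image of [[u, v]], but [g] and [h] live on all of [[m, M]], so
    that approximations for different pieces can be combined. [h] is nonnegative everywhere, so
    adding error functions preserves each bound. *)
Definition approximable_on_image (f Phi : R -> R) (m M u v e : R) : Prop :=
  exists g h, ex_RInt g m M /\ ex_RInt h m M /\ (forall y, 0 <= h y) /\
    (forall t, segment u v t -> Rabs (f (Phi t) - g (Phi t)) <= h (Phi t)) /\
    RInt h m M <= e.

Lemma approximable_on_image_const (f Phi : R -> R) (m M u v p q k D : R) :
  m <= p -> p <= q -> q <= M ->
  (forall t, segment u v t -> segment p q (Phi t)) -> 0 <= D ->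
  (forall t, segment u v t -> Rabs (f (Phi t) - k) <= D) ->
  approximable_on_image f Phi m M u v (D * (q - p)).
Proof.
intros Hmp Hpq HqM Him HD Hk.
assert (Hh : is_RInt (splice p q (fun _ => D) (fun _ => 0)) m M
  (0 * (p - m) + D * (q - p) + 0 * (M - q))).
{ apply is_RInt_splice; auto; apply is_RInt_real_const. }
exists (fun _ => k), (splice p q (fun _ => D) (fun _ => 0)).
repeat split.
- apply ex_RInt_const.
- eexists; exact Hh.
- intros y; unfold splice; destruct (Rle_dec p y); [destruct (Rle_dec y q)|]; lra.
- intros t Ht; rewrite splice_in by exact (Him t Ht); auto.
- rewrite (is_RInt_unique _ _ _ _ Hh); lra.
Qed.

(** On [[p, q]], which is exactly the image of [[u, v]], [g1] is used, and [g2] elsewhere. Since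
    images may overlap, the error functions are added: [h1 + h2] dominates both. *)
Lemma approximable_on_image_Chasles (f Phi : R -> R) (m M u v w p q e1 e2 : R) :
  m <= p -> p <= q -> q <= M ->
  (forall y, image Phi (segment u v) y <-> segment p q y) ->
  approximable_on_image f Phi m M u v e1 ->
  approximable_on_image f Phi m M v w e2 ->
  approximable_on_image f Phi m M u w (e1 + e2).
Proof.
intros Hmp Hpq HqM Him (g1 & h1 & Hg1 & Hh1 & P1 & B1 & E1)
  (g2 & h2 & Hg2 & Hh2 & P2 & B2 & E2).
exists (splice p q g1 g2), (fun y => h1 y + h2 y).
repeat split.
- apply ex_RInt_splice; auto.
- exact (ex_RInt_plus h1 h2 m M Hh1 Hh2).
- intros y; specialize (P1 y); specialize (P2 y); lra.
- intros t [Ht1 Ht2].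
  assert (P1' := P1 (Phi t)); assert (P2' := P2 (Phi t)).
  assert (D : segment p q (Phi t) \/ (Phi t < p \/ q < Phi t)).
  { unfold segment; destruct (Rle_dec p (Phi t)); destruct (Rle_dec (Phi t) q); lra. }
  destruct D as [D|D].
  + rewrite splice_in by exact D.
    (* [Phi t] may be reached from [u, v] although [t] itself is beyond [v] *)
    destruct (proj2 (Him (Phi t)) D) as [s [Hs Es]].
    specialize (B1 s Hs); rewrite Es in B1; lra.
  + rewrite splice_out by exact D.
    destruct (Rle_dec t v) as [Htv|Htv].
    * exfalso.
      assert (Hpt : segment p q (Phi t)) by (apply Him; exists t; repeat split; lra).
      destruct Hpt; lra.
    * assert (B : Rabs (f (Phi t) - g2 (Phi t)) <= h2 (Phi t)) by (apply B2; split; lra).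
      lra.
- assert (E : RInt (fun y => h1 y + h2 y) m M = RInt h1 m M + RInt h2 m M)
    by exact (RInt_plus h1 h2 m M Hh1 Hh2).
  lra.
Qed.

Lemma ex_RInt_of_subst (a b m M K : R) (phi Phi f : R -> R) :
  a <= b -> m <= M -> primitive_on a b phi Phi -> bounded_on phi (segment a b) ->
  (forall y, image Phi (segment a b) y <-> segment m M y) ->
  (forall y, segment m M y -> Rabs (f y) <= K) ->
  ex_RInt (fun x => f (Phi x) * phi x) a b -> ex_RInt f m M.
Proof.
intros Hab HmM Hprim [B HB] Him HK HF.
assert (Hin : forall x, segment a b x -> segment m M (Phi x)).
{ intros x Hx; apply Him; exists x; auto. }
assert (HK0 : 0 <= K).
{ eapply Rle_trans; [apply Rabs_pos|apply (HK m)]; split; lra. }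
assert (HB0 : 0 <= B).
{ eapply Rle_trans; [apply Rabs_pos|apply (HB a)]; split; lra. }
assert (Hphi : ex_RInt phi a b) by (eexists; apply Hprim; lra).
(* Used with the crude [L = B] for gluing, where only the shape of the image matters, and with
   [L = |c| + d] for the cost. *)
assert (Himg : forall L u v, a <= u -> u <= v -> v <= b -> 0 <= L ->
  (forall t, segment u v t -> Rabs (phi t) <= L) ->
  exists p q, m <= p /\ p <= q /\ q <= M /\ q - p <= L * (v - u) /\
    forall y, image Phi (segment u v) y <-> segment p q y).
{ intros L u v Hu Huv Hv HL0 HL.
  destruct (Lipschitz_image_segment L u v Phi) as (p & q & Hpq & Hlen & Hi); auto.
  { apply (primitive_Lipschitz L u v phi Phi); auto.
    apply primitive_subsegment with a b; auto. }
  assert (Hsub : forall y, segment p q y -> segment m M y).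
  { intros y Hy; apply Him.
    destruct (proj2 (Hi y) Hy) as [x [[Hx1 Hx2] Hx]]; exists x; repeat split; auto; lra. }
  exists p, q; repeat split; auto; try apply Hi; auto; apply Hsub; split; lra. }
apply ex_RInt_of_integral_within; [exact HmM|].
intros e He.
(* Per unit length a piece costs [2 * K * d] if [|c| <= d], and [2 * (d' + K * d)] otherwise; both
   are at most [C * (d + d')]. *)
set (C := 2 * K + 2).
assert (HC : 0 < C) by (unfold C; lra).
assert (Happ : approximable_on_image f Phi m M a b (C * (e / C))).
{ apply (ex_RInt_cost_ind2 phi (fun x => f (Phi x) * phi x)
    (fun u v e => approximable_on_image f Phi m M u v (C * e))); auto.
  - exists B; auto.
  - exists (K * B); intros x Hx; rewrite Rabs_mult.
    apply Rmult_le_compat; try apply Rabs_pos; auto.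
  - intros u v w e1 e2 Hu Hv H1 H2.
    destruct (Himg B u v) as (p & q & Hmp & Hpq & HqM & _ & Hi); try lra.
    { intros t [Ht1 Ht2]; apply HB; split; lra. }
    rewrite Rmult_plus_distr_l.
    apply approximable_on_image_Chasles with v p q; auto.
  - intros u v e1 e2 He12 (g & h & Hg & Hh & P & Bd & E).
    exists g, h; repeat split; auto.
    apply Rle_trans with (1 := E), Rmult_le_compat_l; lra.
  - intros u v c d c' d' Hu Huv Hv Hd Hd'.
    assert (Hd0 : 0 <= d).
    { eapply Rle_trans; [apply Rabs_pos|apply (Hd u); split; lra]. }
    assert (Hd0' : 0 <= d').
    { eapply Rle_trans; [apply Rabs_pos|apply (Hd' u); split; lra]. }
    assert (HfK : forall t, segment u v t -> Rabs (f (Phi t)) <= K).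
    { intros t [Ht1 Ht2]; apply HK, Hin; split; lra. }
    assert (Hmono : forall e1 e2, e1 <= e2 -> approximable_on_image f Phi m M u v e1 ->
      approximable_on_image f Phi m M u v e2).
    { intros e1 e2 He12 (g & h & Hg & Hh & P & Bd & E).
      exists g, h; repeat split; auto; lra. }
    assert (Hphic : forall t, segment u v t -> Rabs (phi t) <= Rabs c + d).
    { intros t Ht; replace (phi t) with (c + (phi t - c)) by ring.
      eapply Rle_trans; [apply Rabs_triang|specialize (Hd t Ht); lra]. }
    assert (Hc0 := Rabs_pos c).
    destruct (Himg (Rabs c + d) u v) as (p & q & Hmp & Hpq & HqM & Hlen & Hi); auto; try lra.
    assert (Hpq' : forall t, segment u v t -> segment p q (Phi t)).
    { intros t Ht; apply Hi; exists t; auto. }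
    destruct (Rle_dec (Rabs c) d) as [Hc|Hc].
    + apply Hmono with (K * (q - p)).
      * apply Rle_trans with (K * (2 * d * (v - u))).
        { apply Rmult_le_compat_l; auto.
          eapply Rle_trans; [exact Hlen|apply Rmult_le_compat_r; lra]. }
        replace (K * (2 * d * (v - u))) with ((2 * K * d) * (v - u)) by ring.
        rewrite <- Rmult_assoc; apply Rmult_le_compat_r; [lra|].
        unfold C; nra.
      * apply approximable_on_image_const with 0; auto.
        intros t Ht; rewrite Rminus_0_r; auto.
    + assert (Hcpos : 0 < Rabs c) by lra.
      assert (Hcne : c <> 0) by (intros ->; rewrite Rabs_R0 in Hcpos; lra).
      assert (HD : 0 <= (d' + K * d) / Rabs c).
      { apply Rmult_le_pos; [nra|]. apply Rlt_le, Rinv_0_lt_compat, Hcpos. }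
      apply Hmono with ((d' + K * d) / Rabs c * (q - p)).
      (* Here [|c| + d <= 2 * |c|], so the image length cancels the division by [|c|]. *)
      * apply Rle_trans with ((d' + K * d) / Rabs c * (2 * Rabs c * (v - u))).
        { apply Rmult_le_compat_l; auto.
          eapply Rle_trans; [exact Hlen|apply Rmult_le_compat_r; lra]. }
        replace ((d' + K * d) / Rabs c * (2 * Rabs c * (v - u)))
          with (2 * (d' + K * d) * (v - u)) by (field; lra).
        rewrite <- Rmult_assoc; apply Rmult_le_compat_r; [lra|].
        unfold C; nra.
      * apply approximable_on_image_const with (c' / c); auto.
        intros t Ht.
        replace (f (Phi t) - c' / c)
          with (((f (Phi t) * phi t - c') - f (Phi t) * (phi t - c)) / c) by (field; auto).
        rewrite Rabs_div by auto.
        apply Rmult_le_compat_r; [apply Rlt_le, Rinv_0_lt_compat, Hcpos|].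
        eapply Rle_trans; [apply Rabs_triang|]; rewrite Rabs_Ropp, Rabs_mult.
        apply Rplus_le_compat; [apply Hd', Ht|].
        apply Rmult_le_compat; try apply Rabs_pos; auto.
  - apply Rdiv_lt_0_compat; lra. }
replace (C * (e / C)) with e in Happ by (field; lra).
destruct Happ as (g & h & Hg & Hh & P & Bd & E).
(* The integral of [g] itself is the approximate value, so only [h] contributes an error. *)
exists (RInt g m M), g, h, (RInt g m M), (RInt h m M); repeat split; auto.
- exact (RInt_correct g m M Hg).
- exact (RInt_correct h m M Hh).
- intros y Hy; destruct (proj2 (Him y) Hy) as [x [Hx <-]]; auto.
- rewrite Rminus_diag, Rabs_R0; lra.
Qed.

(** * Passage to the set-based statement *)

(** Equal nonempty segments have equal endpoints, so the endpoints hidden in the definition must be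
    [m] and [M]. *)
Lemma Riemann_integrable_on_segment (g : R -> R) (S : R -> Prop) (m M : R) :
  m <= M -> (forall y, S y <-> segment m M y) ->
  Riemann_integrable_on g S <-> ex_RInt g m M.
Proof.
intros HmM HS; split.
- intros (p & q & Hpq & HS' & Hg).
  assert (Heq : forall y, segment m M y <-> segment p q y).
  { intros y; rewrite <- HS; apply HS'. }
  assert (H1 : segment p q m) by (apply Heq; split; lra).
  assert (H2 : segment p q M) by (apply Heq; split; lra).
  assert (H3 : segment m M p) by (apply Heq; split; lra).
  assert (H4 : segment m M q) by (apply Heq; split; lra).
  unfold segment in *.
  replace m with p by lra; replace M with q by lra; exact Hg.
- intros Hg; exists m, M; auto.
Qed.

Lemma indefinite_integral_primitive (a b : R) (phi Phi : R -> R) :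
  ex_RInt phi a b -> indefinite_integral_on a b phi Phi -> primitive_on a b phi Phi.
Proof.
intros Hphi HPhi x y Hx Hxy Hy.
rewrite (HPhi x), (HPhi y) by (split; lra).
assert (H1 : ex_RInt phi a x) by (apply ex_RInt_subsegment with a b; auto; lra).
assert (H2 : ex_RInt phi x y) by (apply ex_RInt_subsegment with a b; auto; lra).
assert (E : RInt phi a x + RInt phi x y = RInt phi a y) by exact (RInt_Chasles phi a x y H1 H2).
replace (Phi a + RInt phi a y - (Phi a + RInt phi a x)) with (RInt phi x y : R) by lra.
exact (RInt_correct phi x y H2).
Qed.

Theorem mainTheorem1
  (a b : R) (phi Phi f : R -> R)
  (hab : a < b)
  (phi_bounded : bounded_on phi (segment a b))
  (phi_integrable : Riemann_integrable_on phi (segment a b))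
  (Phi_indef : indefinite_integral_on a b phi Phi)
  (f_bounded : bounded_on f (image Phi (segment a b))) :
  (Riemann_integrable_on f (image Phi (segment a b)) <->
   Riemann_integrable_on (fun x => f (Phi x) * phi x) (segment a b)) /\
  (Riemann_integrable_on f (image Phi (segment a b)) ->
   RInt f (Phi a) (Phi b) = RInt (fun x => f (Phi x) * phi x) a b).
Proof.
assert (Hab : a <= b) by lra.
assert (Hseg := fun g => Riemann_integrable_on_segment g (segment a b) a b Hab
  (fun y => iff_refl _)).
assert (Hprim : primitive_on a b phi Phi).
{ apply indefinite_integral_primitive; [apply Hseg|]; auto. }
(* A bound for [phi] is a Lipschitz constant for [Phi], whose range is therefore a segment. *)
assert (Him : exists m M, m <= M /\
  forall y, image Phi (segment a b) y <-> segment m M y).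
{ destruct phi_bounded as [B HB].
  destruct (Lipschitz_image_segment B a b Phi) as (m & M & HmM & _ & Him); auto.
  - eapply Rle_trans; [apply Rabs_pos|apply (HB a)]; split; lra.
  - apply (primitive_Lipschitz B a b phi Phi); auto.
  - exists m, M; auto. }
destruct Him as (m & M & HmM & Him).
destruct f_bounded as [K HK].
assert (HK' : forall y, segment m M y -> Rabs (f y) <= K).
{ intros y Hy; apply HK, Him, Hy. }
rewrite (Riemann_integrable_on_segment f _ m M HmM Him), Hseg.
assert (Hsubst : ex_RInt f m M ->
  is_RInt (fun x => f (Phi x) * phi x) a b (RInt f (Phi a) (Phi b))).
{ intros Hf; apply (is_RInt_subst a b m M K); auto.
  intros x Hx; apply Him; exists x; auto. }
repeat split.
- intros Hf; eexists; exact (Hsubst Hf).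
- apply (ex_RInt_of_subst a b m M K phi Phi f); auto.
- intros Hf; symmetry; exact (is_RInt_unique _ _ _ _ (Hsubst Hf)).
Qed.
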